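(* Let $k,n,N\in\mathbb{N}$ with $1\le k<n$, and let $$\mathcal{K}^n=\mathcal{B}_n+\sum_{i=1}^N\frac{\alpha_i}{p-\beta_i},\qquad \mathcal{B}_n=(\mathcal{K}^n)_{\ge 0},$$ be the $n$-th power of a Sato function $\mathcal{K}=p+\sum_{j\ge1}U_j(T)p^{-j}$, where $\alpha_i=\alpha_i(T)$, $\beta_i=\beta_i(T)$. Put $\mathcal{B}_k=[(\mathcal{K}^n)^{k/n}]_{\ge 0}$. Suppose that the dispersionless KP hierarchy with self-consistent sources holds: for $i=1,\dots,N$, $$(\mathcal{B}_k)_{T_n}-(\mathcal{K}^n)_{T_k}+\{\mathcal{B}_k,\mathcal{K}^n\}=0,\qquad \alpha_{i,T_k}=\Big[\alpha_i\Big(\tfrac{\partial}{\partial p}\mathcal{B}_k(p)\Big)\Big|_{p=\beta_i}\Big]_X,\qquad \beta_{i,T_k}=\big[\mathcal{B}_k(p)|_{p=\beta_i}\big]_X ,$$ and let $P=P(T)$ be a function satisfying the corresponding conservation equations $$P_{T_k}=[\mathcal{B}_k(P)]_X,\qquad P_{T_n}=\Big[\mathcal{B}_n(P)+\sum_{i=1}^N\frac{\alpha_i}{P-\beta_i}\Big]_X .$$ Let $\phi=\phi(T)$ be a function satisfying $$\phi_{T_k}=\mathcal{B}_k|_{p=\phi_X},\qquad \phi_{T_n}=\mathcal{B}_n|_{p=\phi_X}+\sum_{i=1}^N\frac{\alpha_i}{\phi_X-\beta_i}.$$ Define $a_i:=-\alpha_i$, $p_i:=\beta_i-\phi_X$ $(i=1,\dots,N)$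 and $$\mathcal{L}^n:=\big[e^{-ad\phi}(\mathcal{K}^n)\big]_{\ge 1}-\sum_{i=1}^N\Big(\frac{a_i}{p_i}+\frac{a_i}{p-p_i}\Big).$$ Then, with $\mathcal{Q}_k=[(\mathcal{L}^n)^{k/n}]_{\ge 1}$, the dispersionless mKP hierarchy with self-consistent sources holds: for $i=1,\dots,N$, $$(\mathcal{Q}_k)_{T_n}-(\mathcal{L}^n)_{T_k}+\{\mathcal{Q}_k,\mathcal{L}^n\}=0,\qquad a_{i,T_k}=\Big[a_i\Big(\tfrac{\partial}{\partial p}\mathcal{Q}_k(p)\Big)\Big|_{p=p_i}\Big]_X,\qquad p_{i,T_k}=\big[\mathcal{Q}_k(p)|_{p=p_i}\big]_X .$$
   Context: $T=(T_1=X,T_2,T_3,\dots)$ are independent variables and all coefficient functions ($U_j,\alpha_i,\beta_i,\phi$, etc.) are smooth functions of $T$; $p$ is a formal variable independent of $T$. All symbols such as $\mathcal{K},\mathcal{L}$ are formal Laurent series in $p^{-1}$ (finitely many positive powers of $p$) with coefficients functions of $T$; fractions $\frac{1}{p-\beta}$ are expanded as $\sum_{j\ge0}\beta^j p^{-j-1}$. Subscripts $T_k$, $X$ on a Laurent series denote coefficientwise partial derivatives with $p$ held fixed; subscripts on functions of $T$ denote partial derivatives, and $[\,\cdot\,]_X$ applied to an expression evaluated at $p=$ a function of $T$ is the derivative in $X$ of the resulting function of $T$. For $A=\sum_j c_jp^j$, $A_{\ge r}=\sum_{j\ge r}c_jp^j$. The Poisson bracket is $\{A,B\}=\frac{\partial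 A}{\partial p}\frac{\partial B}{\partial X}-\frac{\partial A}{\partial X}\frac{\partial B}{\partial p}$. For a series $M=p^n+\text{(lower powers of }p)$, $M^{1/n}$ is the unique series of the form $p+\text{(lower powers)}$ whose $n$-th power is $M$, and $M^{k/n}=(M^{1/n})^k$. The notation $\mathcal{L}^n$ denotes a series of the form $p^n+\text{lower}$, understood as the $n$-th power of $\mathcal{L}=(\mathcal{L}^n)^{1/n}$. For a function $\phi(T)$ and a series $\mu(p,T)$, $$e^{-ad\phi}(\mu)=\mu-\{\phi,\mu\}+\tfrac1{2!}\{\phi,\{\phi,\mu\}\}-\tfrac{1}{3!}\{\phi,\{\phi,\{\phi,\mu\}\}\}+\cdots=\sum_{l=0}^\infty\frac{1}{l!}(\phi_X)^l\,\partial_p^l\mu .$$ Convention: all denominators occurring that are functions of $T$ (here $\phi_X-\beta_i=-p_i$ and $P-\beta_i$) are nowhere zero. *)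

(* Defs.v *)
From HB Require Import structures.
From mathcomp Require Import all_boot all_order all_algebra.
From mathcomp Require Import all_classical all_reals all_analysis.

Set Implicit Arguments.
Unset Strict Implicit.
Unset Printing Implicit Defensive.

Import Order.TTheory GRing.Theory Num.Theory.
Import numFieldNormedType.Exports.
Local Open Scope classical_set_scope.
Local Open Scope ring_scope.

(* Points T = (T_1, T_2, ...); the value of T_j.+1 is the coordinate j. *)
Definition times (R : realType) : Type := nat -> R.

(* Functions of T carry the pointwise commutative ring structure. *)
Notation tfun R := (times R -> R%type).

Definition set_coord (R : realType) (T : times R) (j : nat) (s : R) : times R :=
  fun i => if i == j then s else T i.

Definition pd (R : realType) (j : nat) (f : tfun R) : tfun R :=
  fun T => derive1 (fun s : R => f (set_coord T j s)) (T j).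

(* f_{T_k}, for k >= 1 *)
Definition dT (R : realType) (k : nat) (f : tfun R) : tfun R := pd k.-1 f.

Definition dX (R : realType) (f : tfun R) : tfun R := dT 1 f.

Definition tdiv (R : realType) (f g : tfun R) : tfun R := fun T => f T / g T.

(* T with its first m coordinates replaced by those of v *)
Definition set_coords (R : realType) (m : nat) (T : times R) (v : 'rV[R]_m) :
    times R :=
  fun j => if insub j is Some i then v 0 i else T j.

(* C^oo in every finite set of the variables (the others being frozen): all
   iterated partial derivatives exist and are jointly continuous in
   (T_1, ..., T_m) for every m. *)
Definition smooth (R : realType) (f : tfun R) : Prop :=
  forall s : seq nat, let g := foldr (@pd R) f s in
    (forall (j : nat) (T : times R),
       derivable (fun t : R => g (set_coord T j t)) (T j) 1) /\
    (forall (m : nat) (T : times R),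
       continuous (fun v : 'rV[R]_m => g (set_coords T v))).

(* A family A represents the formal series \sum_j (A j) p^j. The Laurent series
   in p^-1 are the families vanishing for all large j; on these, and only on
   these, the operations below written with a sum over all of int or nat have
   finite support and their expected meaning (\sum_(i \in _) is 0 when the
   support is infinite). Only the additive structure is inherited from the
   function type, since its pointwise product is not the product of series. *)
Definition lseries (R : realType) : Type := int -> tfun R.

HB.instance Definition _ (R : realType) := GRing.Zmodule.copy (lseries R)
  (int -> tfun R).

Section LaurentSeries.
Variable R : realType.
Implicit Types (A B M : lseries R) (f a b q phi : tfun R).

Definition lconst f : lseries R := fun j => if j == 0 then f else 0.

Definition lmul A B : lseries R :=
  fun j => \sum_(i \in [set: int]) (A i * B (j - i)).

Definition lpow (n : nat) A : lseries R := iter n (lmul A) (lconst 1).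

Definition trunc_ge (r : int) A : lseries R :=
  fun j => if r <= j then A j else 0.

Definition ldp A : lseries R := fun j => A (j + 1) *~ (j + 1).

Definition ldT (k : nat) A : lseries R := fun j => dT k (A j).

Definition ldX A : lseries R := ldT 1 A.

Definition bracket A B : lseries R :=
  lmul (ldp A) (ldX B) - lmul (ldX A) (ldp B).

(* a / (p - b) = \sum_(m >= 0) a b^m p^(- m - 1), with Negz m = - (m + 1) *)
Definition lfrac a b : lseries R :=
  fun j => if j is Negz m then a * b ^+ m else 0.

(* A(q), for A a polynomial in p: negative powers are ignored *)
Definition leval A q : tfun R := \sum_(j \in [set: nat]) (A j%:Z * q ^+ j).

(* A = p^n + (lower powers of p) *)
Definition lmonic (n : nat) A : Prop :=
  A n%:Z = 1 /\ forall j : int, n%:Z < j -> A j = 0.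

(* M^(1/n), well defined when n >= 1 and M = p^n + (lower powers of p) *)
Definition lroot (n : nat) M : lseries R :=
  xget 0 [set A | lmonic 1 A /\ lpow n A = M].

(* M^(k/n) *)
Definition lfracpow (k n : nat) M : lseries R := lpow k (lroot n M).

(* e^(- ad phi) (A) *)
Definition exp_ad_opp phi A : lseries R :=
  fun j => \sum_(l \in [set: nat])
    (cst ((-1) ^+ l / l`!%:R) * iter l (bracket (lconst phi)) A j).

(* p + \sum_(j >= 1) U_j p^(- j), with smooth U_j: no term in p^0 *)
Definition sato A : Prop :=
  [/\ lmonic 1 A, A 0 = 0 & forall j, smooth (A j)].

(* The equations common to the two hierarchies with self-consistent sources:
   for dKP, B = [M^(k/n)]_(>= 0); for dmKP, B = [M^(k/n)]_(>= 1). *)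
Definition source_hierarchy (k n N : nat) B M (a b : 'I_N -> tfun R) : Prop :=
  [/\ ldT n B - ldT k M + bracket B M = 0,
      forall i, dT k (a i) = dX (a i * leval (ldp B) (b i)) &
      forall i, dT k (b i) = dX (leval B (b i))].

End LaurentSeries.

(* Main.v *)
Require Import Defs.
From HB Require Import structures.
From mathcomp Require Import all_boot all_order all_algebra.
From mathcomp Require Import all_classical all_reals all_analysis.
From mathcomp Require Import ring lra zify.

Set Implicit Arguments.
Unset Strict Implicit.
Unset Printing Implicit Defensive.

Import Order.TTheory GRing.Theory Num.Theory.
Import numFieldNormedType.Exports.
Local Open Scope classical_set_scope.
Local Open Scope ring_scope.

(* With u = phi_X, the operator e^(- ad phi) is the substitution S : p -> p + u,
   a ring endomorphism commuting with d/dp.  The p^0 coefficient of S K^n, namely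
   B_n(u), and the constants a_i / p_i add up to phi_{T_n}, so that
   L^n = S K^n - phi_{T_n}.  Subtracting a function from an n-th power changes the
   k-th power of its root only in degrees <= k - n < 0, so
   Q_k = S B_k - B_k(u) = S B_k - phi_{T_k}.  Since
   (S A)_{T_j} = S (A_{T_j}) + u_{T_j} S (dA/dp), the extra terms in the zero
   curvature equation cancel by the symmetry of second derivatives, and the
   source equations follow from (S A)(q) = A(q + u) at q = beta_i - u. *)

(* The bound k - n comes from y^n - z^n = (y - z) G, where G has degree n - 1 and leading
   coefficient n. If y^n - z^n has degree at most 0, dividing by G gives y - z of degree at most 1 -
   n, and multiplying by the analogous factor for k adds k - 1. The division needs care because
   functions of T have zero divisors: degrees may be subtracted only when the leading coefficient is
   regular, as n and 1 are. Two kinds of infinite sums shape the rest. The product of families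
   indexed by all integers is a ring law only on families bounded above, so these are packaged as a
   commutative ring on which algebraic identities can be checked formally. The operator S is an
   infinite Taylor sum; since d/dp lowers degrees, its first L terms are exact up to an error of
   degree at most d - L. An identity for S is thus proved modulo every such degree, and a series of
   arbitrarily low degree is 0. *)
Identity Coercion lseries_fun : lseries >-> Funclass.

(** * The ring of Laurent series in p^-1 *)

Section LaurentAlgebra.
Variable R : realType.
Implicit Types (A B C : lseries R) (a b d j : int).

Definition deg_le d A : Prop := forall j, d < j -> A j = 0.

Lemma deg_le_trans d e A : d <= e -> deg_le d A -> deg_le e A.
Proof. by move=> de dA j ej; apply: dA; apply: le_lt_trans ej. Qed.

Lemma deg_le0 d : deg_le d (0 : lseries R).
Proof. by []. Qed.

Lemma deg_leB d A B : deg_le d A -> deg_le d B -> deg_le d (A - B).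
Proof.
move=> dA dB j dj; rewrite -[LHS]/(A j - B j).
by rewrite dA // dB // subr0.
Qed.

Lemma deg_leD d A B : deg_le d A -> deg_le d B -> deg_le d (A + B).
Proof.
move=> dA dB j dj; rewrite -[LHS]/(A j + B j).
by rewrite dA // dB // addr0.
Qed.

(** Only indices at most a on the left and at most b on the right contribute, so the support has a +
    b - j + 1 elements at most. Any larger [W] is allowed, so that several products can be expanded
    over the same range. *)
Lemma lmul_window a b A B j (W : nat) :
  deg_le a A -> deg_le b B -> a + b - j < W%:Z ->
  lmul A B j = \sum_(i < W) A (a - i%:Z) * B (j - a + i%:Z).
Proof.
move=> dA dB jW; pose h (i : nat) : int := a - i%:Z.
rewrite /lmul (fsbigE [seq h i | i <- iota 0 W]).
- rewrite big_map -[in iota 0 W](subn0 W) -/(index_iota 0 W) big_mkord.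
  rewrite (eq_bigl xpredT) => [|i]; last by rewrite in_setT.
  by apply: eq_bigr => i _; rewrite /h; congr (_ * B _); ring.
- by rewrite map_inj_uniq ?iota_uniq// /h => x y; lia.
- by [].
- move=> i _ /negP iW.
  have [/dA->|ia] := ltP a i; first exact: mul0r.
  have [/dB->|ib] := ltP b (j - i); first exact: mulr0.
  case: iW; apply/mapP; exists (absz (a - i)%R); last by rewrite /h; lia.
  by rewrite mem_iota; lia.
Qed.

Lemma deg_le_mul a b A B :
  deg_le a A -> deg_le b B -> deg_le (a + b) (lmul A B).
Proof.
move=> dA dB j abj; rewrite (lmul_window (W := 0) dA dB) ?big_ord0//.
by rewrite subr_lt0.
Qed.

Lemma lmul_lead a b A B :
  deg_le a A -> deg_le b B -> lmul A B (a + b) = A a * B b.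
Proof.
move=> dA dB; rewrite (lmul_window (W := 1) dA dB) ?subrr//.
by rewrite big_ord1 /= subr0 addr0 addrAC subrr add0r.
Qed.

(* The coefficients of A from degree a downwards; on these, the product of series
   is the product of polynomials in p^-1. *)
Definition top_poly (W : nat) a A : {poly tfun R} :=
  \poly_(i < W) A (a - i%:Z).

Lemma lmul_coef (W : nat) a b A B (m : nat) :
  deg_le a A -> deg_le b B -> (m < W)%N ->
  lmul A B (a + b - m%:Z) = (top_poly W a A * top_poly W b B)`_m.
Proof.
move=> dA dB mW; rewrite (lmul_window (W := m.+1) dA dB); last by lia.
rewrite coefM; apply: eq_bigr => i _; have := ltn_ord i; move=> im.
rewrite !coef_poly !ifT; [|lia|lia].
by congr (_ * B _); lia.
Qed.

Lemma ext_below a A B : deg_le a A -> deg_le a B ->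
  (forall m : nat, A (a - m%:Z) = B (a - m%:Z)) -> A = B.
Proof.
move=> dA dB AB; apply: funext => j; have [aj|ja] := ltP a j.
  by rewrite dA ?dB.
have -> : j = a - (absz (a - j)%R)%:Z by lia.
exact: AB.
Qed.

(** The coefficient m places below the top depends only on the first m + 1 coefficients of each
    factor, so associativity is inherited from truncated polynomials. *)
Lemma lmul_assoc a b d A B C : deg_le a A -> deg_le b B -> deg_le d C ->
  lmul A (lmul B C) = lmul (lmul A B) C.
Proof.
move=> dA dB dC; have dBC := deg_le_mul dB dC; have dAB := deg_le_mul dA dB.
apply: (@ext_below (a + b + d)); first by rewrite -addrA; exact: deg_le_mul.
  exact: deg_le_mul.
move=> m; rewrite -addrA (lmul_window (W := m.+1) dA dBC); last by lia.
rewrite addrA (lmul_window (W := m.+1) dAB dC); last by lia.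
transitivity (top_poly m.+1 a A * (top_poly m.+1 b B * top_poly m.+1 d C))`_m.
  rewrite coefM; apply: eq_bigr => i _; have := ltn_ord i => im.
  rewrite -(lmul_coef dB dC); last by lia.
  by rewrite coef_poly ifT//; congr (_ * lmul _ _ _); lia.
rewrite mulrA coefM; apply: eq_bigr => i _; have := ltn_ord i => im.
rewrite -(lmul_coef dA dB); last by lia.
by rewrite coef_poly ifT; [congr (_ * C _); lia|lia].
Qed.

Lemma lmul_comm a b A B : deg_le a A -> deg_le b B -> lmul A B = lmul B A.
Proof.
move=> dA dB; apply: (@ext_below (a + b)); first exact: deg_le_mul.
  by rewrite addrC; exact: deg_le_mul.
move=> m; rewrite (lmul_coef (W := m.+1) dA dB)// mulrC.
by rewrite -(lmul_coef dB dA)// (addrC b).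
Qed.

Lemma lmul_lconst f A : lmul (lconst f) A = fun j => f * A j.
Proof.
apply: funext => j; rewrite /lmul (fsbigE [:: 0]) //.
  by rewrite big_mkcond big_seq1 /= in_setT /lconst eqxx subr0.
by move=> i _; rewrite inE /lconst => /negPf->; rewrite mul0r.
Qed.

Lemma lmul_distr a b d A B C : deg_le a A -> deg_le b B -> deg_le d C ->
  lmul (A + B) C = lmul A C + lmul B C.
Proof.
move=> dA dB dC.
(* A common degree bound makes the windows of the three products coincide. *)
have {}dA : deg_le (Num.max a b) A.
  by apply: deg_le_trans dA; rewrite le_max lexx.
have {}dB : deg_le (Num.max a b) B.
  by apply: deg_le_trans dB; rewrite le_max lexx orbT.
pose e : int := Num.max a b; rewrite -/e in dA dB.
apply: funext => j; have [W jW] : exists W : nat, (e + d - j < W%:Z)%R.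
  by exists (absz (e + d - j)%R).+1; lia.
rewrite (lmul_window (deg_leD dA dB) dC jW) -[RHS]/(lmul A C j + lmul B C j).
rewrite (lmul_window dA dC jW) (lmul_window dB dC jW) -big_split /=.
by apply: eq_bigr => i _; rewrite -mulrDl.
Qed.

(** * The commutative ring of series bounded above *)

Definition lbounded : {pred lseries R} := fun A => `[< exists d, deg_le d A >].

Lemma lboundedP A : reflect (exists d, deg_le d A) (A \in lbounded).
Proof. exact: asboolP. Qed.

Lemma lbounded_zmod : zmod_closed lbounded.
Proof.
split; first by apply/lboundedP; exists 0; exact: deg_le0.
move=> A B /lboundedP[a dA] /lboundedP[b dB]; apply/lboundedP.
exists (Num.max a b); apply: deg_leB.
  by apply: deg_le_trans dA; rewrite le_max lexx.
by apply: deg_le_trans dB; rewrite le_max lexx orbT.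
Qed.

HB.instance Definition _ := GRing.isZmodClosed.Build (lseries R) lbounded
  lbounded_zmod.

(** Membership only asserts that some bound exists, so that the type is closed under the ring
    operations; explicit degrees are tracked separately by [deg_le]. *)
Record laurent := Laurent { lval :> lseries R; lvalP : lval \in lbounded }.

HB.instance Definition _ := [isSub for lval].
HB.instance Definition _ := [Choice of laurent by <:].
HB.instance Definition _ := [SubChoice_isSubZmodule of laurent by <:].

Definition mkL d A (dA : deg_le d A) : laurent :=
  Laurent (introT (lboundedP A) (ex_intro _ d dA)).

Lemma laurent_deg (x : laurent) : exists d, deg_le d x.
Proof. exact/lboundedP/lvalP. Qed.

Fact mull_subproof (x y : laurent) : lmul x y \in lbounded.
Proof.
have [a dx] := laurent_deg x; have [b dy] := laurent_deg y.
by apply/lboundedP; exists (a + b); exact: deg_le_mul.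
Qed.
Definition mull x y := Laurent (mull_subproof x y).

Lemma deg_le_lconst f : deg_le 0 (lconst f : lseries R).
Proof. by move=> j j0; rewrite /lconst gt_eqF. Qed.

Definition cstl (f : tfun R) : laurent := mkL (deg_le_lconst f).

Lemma laurentP (x y : laurent) : (forall j, x j = y j) -> x = y.
Proof. by move=> xy; apply: val_inj; apply: funext. Qed.

Fact mullA : associative mull.
Proof.
move=> x y z; apply: val_inj.
have [a dx] := laurent_deg x; have [b dy] := laurent_deg y.
by have [d dz] := laurent_deg z; exact: lmul_assoc dx dy dz.
Qed.

Fact mullC : commutative mull.
Proof.
move=> x y; apply: val_inj.
have [a dx] := laurent_deg x; have [b dy] := laurent_deg y.
exact: lmul_comm dx dy.
Qed.

Fact mul1l : left_id (cstl 1) mull.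
Proof. by move=> x; apply: laurentP => j /=; rewrite lmul_lconst mul1r. Qed.

Fact mullDl : left_distributive mull +%R.
Proof.
move=> x y z; apply: val_inj.
have [a dx] := laurent_deg x; have [b dy] := laurent_deg y.
by have [d dz] := laurent_deg z; exact: lmul_distr dx dy dz.
Qed.

Fact cstl1_neq0 : cstl 1 != 0.
Proof.
apply/eqP => /(congr1 (fun x : laurent => x 0)).
rewrite /= /lconst eqxx => /(congr1 (fun f : tfun R => f (fun=> 0))).
exact/eqP/oner_neq0.
Qed.

HB.instance Definition _ := GRing.Zmodule_isComNzRing.Build laurent
  mullA mullC mul1l mullDl cstl1_neq0.

Implicit Types (x y z : laurent) (f g : tfun R).

Lemma lvalM x y : lval (x * y) = lmul x y. Proof. by []. Qed.

Lemma lvalD x y j : (x + y) j = x j + y j. Proof. by []. Qed.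

Lemma lvalB x y j : (x - y) j = x j - y j. Proof. by []. Qed.

Lemma lval_sum (I : Type) (r : seq I) (P : pred I) (F : I -> laurent) j :
  (\sum_(i <- r | P i) F i) j = \sum_(i <- r | P i) F i j.
Proof.
elim: r => [|i r IH]; first by rewrite !big_nil.
by rewrite !big_cons; case: (P i); rewrite // lvalD IH.
Qed.

Lemma lval_lpow n x : lval (x ^+ n) = lpow n x.
Proof. by elim: n => [//|n IH]; rewrite exprS lvalM IH. Qed.

Lemma cstlM f x j : (cstl f * x) j = f * x j.
Proof. by rewrite lvalM lmul_lconst. Qed.

Fact cstl_is_monoid_morphism : monoid_morphism cstl.
Proof.
split=> // f g; apply: laurentP => j; rewrite cstlM /= /lconst.
by case: eqP => // _; rewrite mulr0.
Qed.
Fact cstl_is_zmod_morphism : zmod_morphism cstl.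
Proof.
move=> f g; apply: laurentP => j; rewrite lvalB /= /lconst.
by case: eqP => // _; rewrite subr0.
Qed.
HB.instance Definition _ := GRing.isZmodMorphism.Build _ _ cstl
  cstl_is_zmod_morphism.
HB.instance Definition _ := GRing.isMonoidMorphism.Build _ _ cstl
  cstl_is_monoid_morphism.

(** * Degree bounds, cancellation and n-th roots *)

Lemma deg_leM a b x y : deg_le a x -> deg_le b y -> deg_le (a + b) (x * y).
Proof. exact: deg_le_mul. Qed.

Lemma deg_le_sum (I : Type) (r : seq I) (P : pred I) (F : I -> laurent) d :
  (forall i, P i -> deg_le d (F i)) -> deg_le d (\sum_(i <- r | P i) F i).
Proof.
by move=> dF j dj; rewrite lval_sum big1 // => i Pi; exact: dF.
Qed.

Lemma deg_le_cstlM d f x : deg_le d x -> deg_le d (cstl f * x).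
Proof. by move=> dx j dj; rewrite cstlM dx // mulr0. Qed.

Lemma deg_le_all0 x : (forall m : nat, deg_le (- m%:Z) x) -> x = 0.
Proof. by move=> dx; apply: laurentP => j; apply: (dx `|j|.+1); lia. Qed.

(** While the bound on x exceeds d - e, its top coefficient times the regular [y e] is a coefficient
    of x y in degree above d, hence 0, and the bound drops by one. *)
Lemma deg_le_cancel d e x y : deg_le e y -> (forall f, f * y e = 0 -> f = 0) ->
  deg_le d (x * y) -> deg_le (d - e) x.
Proof.
move=> dy yreg dxy; have [c dc] := laurent_deg x.
(* Any bound c is relaxed to d - e plus a natural number, on which the descent is an induction. *)
have : deg_le (d - e + (absz (c - d + e)%R)%:Z) x by apply: deg_le_trans dc; lia.
elim: (X in X%:Z) => [|m IH]; first by rewrite addr0.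
move=> dx; apply: IH => j jm; have [/dx//|jm'] := ltP (d - e + m.+1%:Z) j.
have {jm jm'} jE : j = d - e + m.+1%:Z by lia.
apply: yreg; rewrite jE -(lmul_lead dx dy); apply: dxy; lia.
Qed.

Definition monic_deg n x : Prop := deg_le n x /\ x n = 1.

Lemma lmonicE n x : lmonic n x <-> monic_deg n%:Z x.
Proof. by split=> -[]. Qed.

Lemma monic_degM a b x y :
  monic_deg a x -> monic_deg b y -> monic_deg (a + b) (x * y).
Proof.
move=> [dx x1] [dy y1]; split; first exact: deg_leM.
by rewrite lvalM lmul_lead // x1 y1 mulr1.
Qed.

Lemma monic_degX n x : monic_deg 1 x -> monic_deg n%:Z (x ^+ n).
Proof.
move=> x1; elim: n => [|n IH]; first by split; first exact: deg_le_lconst.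
by rewrite exprS intS; exact: monic_degM.
Qed.

(** The quotient of x^n - y^n by x - y, in the form of [subrXX]. For monic x and y of degree 1 its n
    terms are all monic of degree n - 1, whence the leading coefficient n. *)
Definition pow_cofactor n x y := \sum_(i < n) x ^+ (n.-1 - i) * y ^+ i.

Lemma pow_cofactor_lead n x y : (0 < n)%N -> monic_deg 1 x -> monic_deg 1 y ->
  deg_le n.-1%:Z (pow_cofactor n x y) /\ pow_cofactor n x y n.-1%:Z = n%:R.
Proof.
move=> n0 mx my.
have mi (i : 'I_n) : monic_deg n.-1%:Z (x ^+ (n.-1 - i) * y ^+ i).
  have -> : n.-1%:Z = (n.-1 - i)%N%:Z + i%:Z by have := ltn_ord i; lia.
  by apply: monic_degM; exact: monic_degX.
split; first by apply: deg_le_sum => i _; have [] := mi i.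
rewrite lval_sum (eq_bigr (fun=> 1)) => [|i _]; last by have [] := mi i.
by rewrite sumr_const card_ord.
Qed.

Lemma natr_tfun n : (n%:R : tfun R) = cst n%:R.
Proof.
apply: funext => T; elim: n => [//|n IH].
by rewrite -addn1 natrD -[LHS]/((n%:R : tfun R) T + 1) IH /= natrD.
Qed.

Lemma tfun_natr_reg n f : (0 < n)%N -> f * n%:R = 0 -> f = 0.
Proof.
move=> n0 fn; apply: funext => T.
have : f T * n%:R = 0.
  have := congr1 (fun h : tfun R => h T) fn.
  by rewrite -[LHS]/(f T * (n%:R : tfun R) T) natr_tfun.
by move/eqP; rewrite mulf_eq0 pnatr_eq0 -[n == 0]negbK -lt0n n0 orbF => /eqP.
Qed.

Lemma deg_le_root n d x y : (0 < n)%N -> monic_deg 1 x -> monic_deg 1 y ->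
  deg_le d (x ^+ n - y ^+ n) -> deg_le (d - n.-1%:Z) (x - y).
Proof.
move=> n0 mx my; have [dG G1] := pow_cofactor_lead n0 mx my.
rewrite subrXX; apply: deg_le_cancel => // f; rewrite G1.
exact: tfun_natr_reg.
Qed.

Lemma deg_le_subX n d x y : (0 < n)%N -> monic_deg 1 x -> monic_deg 1 y ->
  deg_le d (x - y) -> deg_le (d + n.-1%:Z) (x ^+ n - y ^+ n).
Proof.
move=> n0 mx my dxy; rewrite subrXX; apply: deg_leM => //.
by have [] := pow_cofactor_lead n0 mx my.
Qed.

Lemma root_unique n x y : (0 < n)%N -> monic_deg 1 x -> monic_deg 1 y ->
  x ^+ n = y ^+ n -> x = y.
Proof.
move=> n0 mx my xy; apply/eqP; rewrite -subr_eq0; apply/eqP/deg_le_all0 => m.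
have -> : - m%:Z = n.-1%:Z - m%:Z - n.-1%:Z by ring.
by apply: (deg_le_root (n := n)) => //; rewrite xy subrr; exact: deg_le0.
Qed.

Definition lmono_fun d f : lseries R := fun j => if j == d then f else 0.
Lemma deg_le_mono d f : deg_le d (lmono_fun d f).
Proof. by move=> j dj; rewrite /lmono_fun gt_eqF. Qed.
Definition lmono d f : laurent := mkL (@deg_le_mono d f).

Section RootExistence.
Variables (n : nat) (M : laurent).
Hypotheses (n0 : (0 < n)%N) (mM : monic_deg n%:Z M).

(* Correcting g by c p^(- m) changes g^n by n c in degree n - 1 - m, up to lower
   powers, so one more coefficient of M is matched at each step. *)
Fixpoint root_approx (m : nat) : laurent :=
  if m isn't m'.+1 then lmono 1 1 else
  let g := root_approx m' in
  g + lmono (- m'%:Z) (cst n%:R^-1 * (M - g ^+ n) (n.-1%:Z - m'%:Z)).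

Lemma root_approxS m : root_approx m.+1 = root_approx m +
  lmono (- m%:Z) (cst n%:R^-1 * (M - root_approx m ^+ n) (n.-1%:Z - m%:Z)).
Proof. by []. Qed.

Lemma monic_root_approx m : monic_deg 1 (root_approx m).
Proof.
elim: m => [|m [dg g1]]; first by split; first exact: deg_le_mono.
split; last first.
  by rewrite root_approxS lvalD g1 /= /lmono_fun gt_eqF ?addr0 //; lia.
rewrite root_approxS.
by apply: deg_leD => //; apply: deg_le_trans (@deg_le_mono _ _); lia.
Qed.

Lemma root_approxP m : deg_le (n.-1%:Z - m%:Z) (M - root_approx m ^+ n).
Proof.
elim: m => [|m IH].
  rewrite subr0 => j jn; rewrite lvalB.
  have [dX X1] := monic_degX n (monic_root_approx 0); case: mM => dM M1.
  have [/[dup] /dM-> /dX->|jn'] := ltP n%:Z j; first by rewrite subrr.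
  have -> : j = n%:Z by lia.
  by rewrite M1 X1 subrr.
have mg := monic_root_approx m; have mg' := monic_root_approx m.+1.
set g := root_approx m in mg IH.
set c := cst n%:R^-1 * (M - g ^+ n) (n.-1%:Z - m%:Z).
have g'E : root_approx m.+1 = g + lmono (- m%:Z) c := root_approxS m.
set g' := root_approx m.+1 in mg' g'E *.
have [dG G1] := pow_cofactor_lead n0 mg' mg.
have gX : g' ^+ n - g ^+ n = lmono (- m%:Z) c * pow_cofactor n g' g.
  by rewrite subrXX g'E addrAC subrr add0r.
have d' : deg_le (n.-1%:Z - m%:Z) (g' ^+ n - g ^+ n).
  by rewrite gX addrC; apply: deg_leM => //; exact: deg_le_mono.
have -> : M - g' ^+ n = (M - g ^+ n) - (g' ^+ n - g ^+ n) by ring.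
move=> j jm; have [jm'|jm'] := ltP (n.-1%:Z - m%:Z) j.
  by apply: (deg_leB IH d').
have -> : j = n.-1%:Z - m%:Z by lia.
rewrite lvalB gX lvalM [_ - m%:Z]addrC (lmul_lead _ dG); last exact: deg_le_mono.
rewrite G1 /= /lmono_fun eqxx /c [- m%:Z + _]addrC mulrAC natr_tfun.
rewrite -[X in _ - X * _]/(cst (n%:R^-1 * n%:R)) mulVf ?pnatr_eq0 -?lt0n//.
by rewrite -[cst 1]/(1 : tfun R) mul1r subrr.
Qed.

(** Step m only alters the coefficient of degree - m, so the coefficient of degree j is final once m
    > - j; the index [|j|.+1] always qualifies, which justifies the diagonal limit [root_fun]. *)
Lemma root_approx_stable m j : - m%:Z < j ->
  root_approx m j = root_approx `|j|.+1 j.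
Proof.
have step m' : - m'%:Z < j -> root_approx m'.+1 j = root_approx m' j.
  move=> jm; rewrite root_approxS lvalD /= /lmono_fun gt_eqF ?addr0 //.
have climb m' e : - m'%:Z < j -> root_approx (m' + e) j = root_approx m' j.
  move=> jm; elim: e => [|e IH]; first by rewrite addn0.
  by rewrite addnS step //; lia.
move=> jm; rewrite -(climb m `|j|.+1) // addnC climb //; lia.
Qed.

Definition root_fun : lseries R := fun j => root_approx `|j|.+1 j.

Lemma deg_le_root_fun : deg_le 1 root_fun.
Proof. by move=> j j1; have [dg _] := monic_root_approx `|j|.+1; exact: dg. Qed.

Lemma monic_root_exists : exists x, monic_deg 1 x /\ x ^+ n = M.
Proof.
pose x := mkL deg_le_root_fun; exists x.
have mx : monic_deg 1 x.
  by split; [exact: deg_le_root_fun | have [] := monic_root_approx 2].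
split=> //; apply/eqP; rewrite -subr_eq0; apply/eqP/deg_le_all0 => m.
(* With this e both errors have degree at most - m: that of x^n - g^n is at most - e + (n - 1), and
   that of M - g^n at most (n - 1) - e. *)
pose e := (m + n.-1)%N; set g := root_approx e.
have -> : x ^+ n - M = (x ^+ n - g ^+ n) - (M - g ^+ n) by ring.
have -> : - m%:Z = - e%:Z + n.-1%:Z by rewrite /e; lia.
apply: deg_leB; last by rewrite addrC; exact: root_approxP.
apply: deg_le_subX => //; first exact: monic_root_approx.
by move=> j je; rewrite lvalB /x /= /root_fun /g root_approx_stable // subrr.
Qed.

End RootExistence.

(** Since a root exists, the choice made by [lroot] is a genuine root and not the default 0. *)
Lemma lroot_exists n x : (0 < n)%N -> monic_deg n%:Z x ->
  exists y, [/\ lroot n x = lval y, monic_deg 1 y & y ^+ n = x].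
Proof.
move=> n0 /(monic_root_exists n0)[y [my yx]].
have : [set A | lmonic 1 A /\ lpow n A = lval x] (lroot n x).
  apply: xgetPex; exists (lval y); split; last by rewrite -lval_lpow yx.
  exact/lmonicE.
move=> [lm lp]; have dz : deg_le 1 (lroot n x) by case: lm.
exists (mkL dz); split=> //; first exact/(lmonicE 1).
by apply: val_inj; rewrite [LHS]lval_lpow.
Qed.

End LaurentAlgebra.

(** * The shift p -> p + u *)

Section ShiftOperator.
Variable R : realType.
Implicit Types (A B : lseries R) (x y : laurent R) (f g q u : tfun R).
Implicit Types (d j : int) (l L : nat).

Lemma deg_le_ldp d A : deg_le d A -> deg_le (d - 1) (ldp A).
Proof. by move=> dA j dj; rewrite /ldp dA ?mul0rz//; lia. Qed.

Fact dp_subproof x : ldp x \in @lbounded R.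
Proof.
have [d dx] := laurent_deg x; apply/lboundedP.
by exists (d - 1); exact: deg_le_ldp.
Qed.
Definition dp x : laurent R := Laurent (dp_subproof x).

Lemma deg_le_dp d x : deg_le d x -> deg_le (d - 1) (dp x).
Proof. exact: deg_le_ldp. Qed.

Fact dp_is_zmod_morphism : zmod_morphism dp.
Proof. by move=> x y; apply: laurentP => j; exact: mulrzBl. Qed.
HB.instance Definition _ := GRing.isZmodMorphism.Build _ _ dp
  dp_is_zmod_morphism.

Lemma dpE x j : dp x j = x (j + 1) *~ (j + 1). Proof. by []. Qed.

Lemma dpM x y : dp (x * y) = dp x * y + x * dp y.
Proof.
have [a dx] := laurent_deg x; have [b dy] := laurent_deg y.
apply: laurentP => j.
(* One window serves all three products; termwise, the exponents of the two factors add up to j + 1,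
   the factor produced by differentiating the product. *)
pose W := (absz (a + b - j)%R).+1.
have W1 : (a + b - (j + 1) < W%:Z)%R by rewrite /W; lia.
have W2 : (a - 1 + b - j < W%:Z)%R by rewrite /W; lia.
have W3 : (a + (b - 1) - j < W%:Z)%R by rewrite /W; lia.
rewrite dpE lvalD !lvalM (lmul_window dx dy W1).
rewrite (lmul_window (deg_le_dp dx) dy W2) (lmul_window dx (deg_le_dp dy) W3).
rewrite mulrz_suml -big_split; apply: eq_bigr => i _ /=.
rewrite /ldp.
have -> : a - 1 - i%:Z + 1 = a - i%:Z by ring.
have -> : j - (a - 1) + i%:Z = j + 1 - a + i%:Z by ring.
have -> : j - a + i%:Z + 1 = j + 1 - a + i%:Z by ring.
rewrite mulrzAl !mulrzAr -mulrzDr; congr (_ *~ _); ring.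
Qed.

Lemma dp_cstl f : dp (cstl f) = 0.
Proof.
apply: laurentP => j; rewrite dpE /= /lconst.
by case: eqP => [->|_]; rewrite ?mulr0z ?mul0rz.
Qed.

Lemma dp_cstlM f x : dp (cstl f * x) = cstl f * dp x.
Proof. by rewrite dpM dp_cstl mul0r add0r. Qed.

(** * Taylor terms and their sum, the shift *)

Definition ddir u x : laurent R := cstl u * dp x.

Fact ddir_is_zmod_morphism u : zmod_morphism (ddir u).
Proof. by move=> x y; rewrite /ddir raddfB mulrBr. Qed.
HB.instance Definition _ u := GRing.isZmodMorphism.Build _ _ (ddir u)
  (ddir_is_zmod_morphism u).

Lemma ddirM u x y : ddir u (x * y) = ddir u x * y + x * ddir u y.
Proof. by rewrite /ddir dpM; ring. Qed.

Lemma ddir_cstlM u f x : ddir u (cstl f * x) = cstl f * ddir u x.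
Proof. by rewrite /ddir dp_cstlM mulrCA. Qed.

Definition inv_fact l : laurent R := cstl (cst (l`!%:R^-1)).

Lemma inv_factS l : inv_fact l.+1 *+ l.+1 = inv_fact l.
Proof.
rewrite /inv_fact -raddfMn; congr cstl; rewrite natmulfctE.
apply: funext => T /=; rewrite -[_ *+ l.+1]mulr_natr factS natrM invfM.
by rewrite mulrAC mulVf ?mul1r // pnatr_eq0.
Qed.

Lemma inv_fact0 : inv_fact 0 = 1.
Proof. by rewrite /inv_fact fact0 invr1. Qed.

Lemma laurent_mulrIn l x y : x *+ l.+1 = y *+ l.+1 -> x = y.
Proof.
move=> xy; have inv : cstl (cst (l.+1%:R^-1)) * l.+1%:R = 1 :> laurent R.
  rewrite -(rmorph_nat (@cstl R)) -rmorphM natr_tfun -[RHS](rmorph1 (@cstl R)).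
  by congr cstl; apply: funext => T; rewrite -[LHS]/(_^-1 * _) mulVf ?pnatr_eq0.
rewrite -[x]mul1r -[y]mul1r -inv -!mulrA.
by rewrite [l.+1%:R * x]mulr_natl [l.+1%:R * y]mulr_natl xy.
Qed.

(* (u^l / l!) (d/dp)^l *)
Definition taylor_term u l x : laurent R := inv_fact l * iter l (ddir u) x.

Lemma taylor_term0 u x : taylor_term u 0 x = x.
Proof. by rewrite /taylor_term inv_fact0 mul1r. Qed.

Lemma taylor_termS u l x :
  taylor_term u l.+1 x *+ l.+1 = ddir u (taylor_term u l x).
Proof. by rewrite /taylor_term ddir_cstlM -mulrnAl inv_factS. Qed.

Lemma iter_ddir_is_zmod_morphism u l : zmod_morphism (iter l (ddir u)).
Proof. by move=> x y; elim: l => //= l ->; rewrite raddfB. Qed.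

Fact taylor_term_is_zmod_morphism u l : zmod_morphism (taylor_term u l).
Proof.
by move=> x y; rewrite /taylor_term iter_ddir_is_zmod_morphism mulrBr.
Qed.
HB.instance Definition _ u l := GRing.isZmodMorphism.Build _ _
  (taylor_term u l) (taylor_term_is_zmod_morphism u l).

(** The Leibniz rule with divided powers, which has no binomials. The induction step is proved after
    multiplication by l + 1, an injective operation by [laurent_mulrIn]. *)
Lemma taylor_termM u l x y : taylor_term u l (x * y) =
  \sum_(i < l.+1) taylor_term u i x * taylor_term u (l - i) y.
Proof.
elim: l => [|l IH]; first by rewrite big_ord1 !taylor_term0.
apply: (@laurent_mulrIn l); rewrite taylor_termS IH raddf_sum /=.
rewrite -sumrMnl.
(* The weight l + 1 of the i-th product splits as i, from deriving the left factor, plus l + 1 - i,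
   from deriving the right one; the end terms added to each sum have weight 0. *)
transitivity (\sum_(i < l.+2)
    (taylor_term u i x *+ i * taylor_term u (l.+1 - i) y) +
  \sum_(i < l.+2)
    (taylor_term u i x * (taylor_term u (l.+1 - i) y *+ (l.+1 - i)))).
  rewrite [X in _ = X + _]big_ord_recl mulr0n mul0r add0r.
  rewrite [X in _ = _ + X]big_ord_recr /= subnn.
  rewrite mulr0n mulr0 addr0 -big_split; apply: eq_bigr => i _ /=.
  rewrite ddirM /bump add1n subSS taylor_termS subSn ?taylor_termS //.
  by have := ltn_ord i; lia.
rewrite -big_split; apply: eq_bigr => i _ /=.
rewrite mulrnAl mulrnAr -mulrnDr subnKC //; have := ltn_ord i; lia.
Qed.

Lemma deg_le_iter_ddir d u l x : deg_le d x ->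
  deg_le (d - l%:Z) (iter l (ddir u) x).
Proof.
move=> dx; elim: l => [|l IH]; first by rewrite subr0.
rewrite iterS; apply: deg_le_cstlM; have := deg_le_dp IH.
by rewrite intS opprD addrA addrAC.
Qed.

Lemma deg_le_taylor_term d u l x : deg_le d x ->
  deg_le (d - l%:Z) (taylor_term u l x).
Proof. by move=> dx; apply/deg_le_cstlM/deg_le_iter_ddir. Qed.

Definition taylor_sum u L x : laurent R := \sum_(l < L) taylor_term u l x.

Definition shift_fun u x : lseries R :=
  fun j => \sum_(l \in [set: nat]) taylor_term u l x j.

(** The l-th Taylor term has degree at most d - l, so the terms with l >= L do not reach degree
    j. *)
Lemma shift_window d u x j L : deg_le d x -> d - L%:Z < j ->
  shift_fun u x j = taylor_sum u L x j.
Proof.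
move=> dx jL; rewrite /shift_fun (fsbigE (iota 0 L)).
- rewrite -[in iota 0 L](subn0 L) -/(index_iota 0 L) big_mkord.
  by rewrite (eq_bigl xpredT) ?lval_sum// => i; rewrite in_setT.
- exact: iota_uniq.
- by [].
- move=> l _; rewrite mem_iota /= add0n -leqNgt => Ll.
  have := @deg_le_taylor_term d u l x dx j; apply; lia.
Qed.

Lemma deg_le_pshift_fun d u x : deg_le d x -> deg_le d (shift_fun u x).
Proof.
move=> dx j dj; rewrite (shift_window (L := 0) u dx) ?subr0//.
by rewrite /taylor_sum big_ord0.
Qed.

Fact shift_subproof u x : shift_fun u x \in @lbounded R.
Proof.
have [d dx] := laurent_deg x; apply/lboundedP.
by exists d; exact: deg_le_pshift_fun.
Qed.
Definition pshift u x : laurent R := Laurent (shift_subproof u x).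

Lemma deg_le_pshift d u x : deg_le d x -> deg_le d (pshift u x).
Proof. exact: deg_le_pshift_fun. Qed.

Lemma shift_approx d u x L : deg_le d x ->
  deg_le (d - L%:Z) (pshift u x - taylor_sum u L x).
Proof. by move=> dx j dj; rewrite lvalB -(shift_window u dx dj) subrr. Qed.

Lemma deg_le_all0_from d x : (forall L, deg_le (d - L%:Z) x) -> x = 0.
Proof.
move=> dx; apply: deg_le_all0 => m.
by apply: deg_le_trans (dx (absz d + m)%N); lia.
Qed.

Lemma taylor_sum_is_zmod_morphism u L : zmod_morphism (taylor_sum u L).
Proof.
by move=> x y; rewrite -sumrB; apply: eq_bigr => l _; rewrite raddfB.
Qed.

Fact shift_is_zmod_morphism u : zmod_morphism (pshift u).
Proof.
move=> x y; have [a dx] := laurent_deg x; have [b dy] := laurent_deg y.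
apply/eqP; rewrite -subr_eq0; apply/eqP.
pose c : int := Num.max a b.
have {}dx : deg_le c x by apply: deg_le_trans dx; rewrite le_max lexx.
have {}dy : deg_le c y by apply: deg_le_trans dy; rewrite le_max lexx orbT.
apply: (@deg_le_all0_from c) => L.
have -> : pshift u (x - y) - (pshift u x - pshift u y) =
    (pshift u (x - y) - taylor_sum u L (x - y)) -
    ((pshift u x - taylor_sum u L x) - (pshift u y - taylor_sum u L y)).
  by rewrite taylor_sum_is_zmod_morphism; ring.
apply: deg_leB; first by apply: shift_approx; exact: deg_leB.
by apply: deg_leB; exact: shift_approx.
Qed.
HB.instance Definition _ u := GRing.isZmodMorphism.Build _ _ (pshift u)
  (shift_is_zmod_morphism u).

Lemma pshiftD u x y : pshift u (x + y) = pshift u x + pshift u y.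
Proof. exact: raddfD. Qed.

Lemma pshiftB u x y : pshift u (x - y) = pshift u x - pshift u y.
Proof. exact: raddfB. Qed.

(* With the terms as coefficients of polynomials in a bookkeeping variable set to 1,
   the terms of index < L of the product agree by the Leibniz rule. *)
Lemma taylor_sumM_approx a b u x y L : deg_le a x -> deg_le b y ->
  deg_le (a + b - L%:Z)
    (taylor_sum u L x * taylor_sum u L y - taylor_sum u L (x * y)).
Proof.
move=> dx dy.
pose X : {poly laurent R} := \poly_(i < L) taylor_term u i x.
pose Y : {poly laurent R} := \poly_(i < L) taylor_term u i y.
have hE z : (\poly_(i < L) taylor_term u i z).[1] = taylor_sum u L z.
  rewrite (horner_coef_wide _ (size_poly _ _)); apply: eq_bigr => i _.
  by rewrite coef_poly ltn_ord expr1n mulr1.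
have sXY : (size (X * Y)%R <= L + L)%N.
  apply: leq_trans (size_polyMleq _ _) _.
  by apply: leq_trans (leq_pred _) _; rewrite leq_add ?size_poly.
have -> : taylor_sum u L x * taylor_sum u L y =
    \sum_(l < L) (X * Y)`_l + \sum_(l < L) (X * Y)`_(L + l).
  rewrite -(hE x) -(hE y) -hornerM (horner_coef_wide _ sXY) big_split_ord.
  by congr (_ + _); apply: eq_bigr => l _; rewrite expr1n mulr1.
have -> : taylor_sum u L (x * y) = \sum_(l < L) (X * Y)`_l.
  apply: eq_bigr => l _; rewrite taylor_termM coefM.
  apply: eq_bigr => i _; have := ltn_ord l; have := ltn_ord i => il lL.
  by rewrite !coef_poly !ifT //; lia.
(* What is left are products of Taylor terms whose orders sum to L + l, hence of degree at most a +
   b - L. *)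
rewrite (@addrAC (laurent R)) subrr add0r; apply: deg_le_sum => l _; rewrite coefM.
apply: deg_le_sum => i _; have := ltn_ord i => il; rewrite !coef_poly.
case: ifP => _; last by rewrite mul0r; exact: deg_le0.
case: ifP => _; last by rewrite mulr0; exact: deg_le0.
apply: deg_le_trans (deg_leM (deg_le_taylor_term u (l := i) dx)
  (deg_le_taylor_term u (l := L + l - i) dy)); lia.
Qed.

Lemma pshiftM u x y : pshift u (x * y) = pshift u x * pshift u y.
Proof.
have [a dx] := laurent_deg x; have [b dy] := laurent_deg y.
apply/eqP; rewrite -subr_eq0; apply/eqP/(@deg_le_all0_from (a + b)) => L.
(* Every summand contains a truncation error of degree lowered by at least L; the product of the two
   partial sums is compared with that of the full shifts, whose degrees are known. *)
have -> : pshift u (x * y) - pshift u x * pshift u y =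
    (pshift u (x * y) - taylor_sum u L (x * y))
    - (taylor_sum u L x * taylor_sum u L y - taylor_sum u L (x * y))
    - (pshift u x - taylor_sum u L x) * pshift u y
    + (pshift u y - taylor_sum u L y) * (pshift u x - taylor_sum u L x)
    - (pshift u y - taylor_sum u L y) * pshift u x.
  by ring.
have Dx := shift_approx u (L := L) dx; have Dy := shift_approx u (L := L) dy.
have Sx := deg_le_pshift u dx; have Sy := deg_le_pshift u dy.
apply: deg_leB; last by apply: deg_le_trans (deg_leM Dy Sx); lia.
apply: deg_leD; last by apply: deg_le_trans (deg_leM Dy Dx); lia.
apply: deg_leB; last by apply: deg_le_trans (deg_leM Dx Sy); lia.
apply: deg_leB; last exact: taylor_sumM_approx.
exact/shift_approx/deg_leM.
Qed.

Lemma shift_eq_finite u x y L0 :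
  (forall L, (L0 <= L)%N -> taylor_sum u L x = y) -> pshift u x = y.
Proof.
move=> xy; have [d dx] := laurent_deg x; apply: laurentP => j.
rewrite -[LHS]/(shift_fun u x j).
pose L := (maxn L0 (absz (d - j)%R).+1); have L0L : (L0 <= L)%N by rewrite /L; lia.
by rewrite (shift_window (L := L) u dx) ?xy // /L; lia.
Qed.

Lemma iter_ddir0 u l : iter l (ddir u) 0 = 0.
Proof. by elim: l => //= l ->; rewrite raddf0. Qed.

Lemma pshift_cstl u f : pshift u (cstl f) = cstl f.
Proof.
apply: (@shift_eq_finite _ _ _ 1) => -[//|L] _.
rewrite /taylor_sum big_ord_recl taylor_term0 big1 ?addr0 // => l _.
by rewrite /taylor_term iterSr /ddir dp_cstl mulr0 iter_ddir0 mulr0.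
Qed.

Fact shift_is_monoid_morphism u : monoid_morphism (pshift u).
Proof. by split=> [|x y]; [exact: pshift_cstl | exact: pshiftM]. Qed.
HB.instance Definition _ u := GRing.isMonoidMorphism.Build _ _ (pshift u)
  (shift_is_monoid_morphism u).

(* The series p *)
Definition varl : laurent R := lmono 1 1.

Lemma varlM x j : (varl * x) j = x (j - 1).
Proof.
rewrite lvalM /lmul (fsbigE [:: 1]) //.
  by rewrite big_mkcond big_seq1 /= in_setT /lmono_fun eqxx mul1r.
by move=> i _; rewrite inE /= /lmono_fun => /negPf->; rewrite mul0r.
Qed.

Lemma dp_varl : dp varl = 1.
Proof.
apply: laurentP => j; rewrite dpE /= /lmono_fun /lconst.
have [->|j0] := eqVneq j 0; first by rewrite add0r eqxx.
by rewrite ifF ?mul0rz //; lia.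
Qed.

Lemma pshift_varl u : pshift u varl = varl + cstl u.
Proof.
apply: (@shift_eq_finite _ _ _ 2) => -[//|[//|L]] _.
rewrite /taylor_sum !big_ord_recl taylor_term0 big1 => [|l _].
  by rewrite addr0 /taylor_term /inv_fact invr1 mul1r /= /ddir dp_varl mulr1.
rewrite /taylor_term !iterSr /ddir dp_varl mulr1 dp_cstl mulr0.
by rewrite iter_ddir0 mulr0.
Qed.

Lemma deg_le_lfrac f q : deg_le (- 1) (lfrac f q).
Proof. by case=> [m _|m]; [|rewrite NegzE; lia]. Qed.
(* f / (p - q) *)
Definition fracl f q : laurent R := mkL (@deg_le_lfrac f q).

Lemma fracl_eq f q : (varl - cstl q) * fracl f q = cstl f.
Proof.
apply: laurentP => j; rewrite mulrBl lvalB varlM cstlM /= /lconst.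
case: j => [[|m]|m].
- have -> : 0%:Z - 1 = Negz 0 by [].
  by rewrite /= mulr0 subr0 expr0 mulr1.
- have -> : m.+1%:Z - 1 = m%:Z by lia.
  by rewrite /= mulr0 subr0.
- have -> : Negz m - 1 = Negz m.+1 by lia.
  by rewrite /= exprS; ring.
Qed.

(** The factor p - q has leading coefficient 1 and can be cancelled. With [fracl_eq] this
    characterizes the fraction, so that its shift is found without re-expanding a geometric
    series. *)
Lemma varl_reg q x y :
  (varl - cstl q) * x = (varl - cstl q) * y -> x = y.
Proof.
move=> xy; apply/eqP; rewrite -subr_eq0; apply/eqP/deg_le_all0 => m.
have lead : deg_le 1 (varl - cstl q).
  apply: deg_leB; first exact: deg_le_mono.
  exact: deg_le_trans (@deg_le_lconst _ _).
have -> : - m%:Z = 1 - m%:Z - 1 by ring.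
apply: (deg_le_cancel (y := varl - cstl q)) => //.
  by move=> f; rewrite lvalB /= /lmono_fun /lconst /= subr0 mulr1.
by rewrite mulrC mulrBr xy subrr; exact: deg_le0.
Qed.

Lemma pshift_fracl u f q : pshift u (fracl f q) = fracl f (q - u).
Proof.
apply: (@varl_reg (q - u)); rewrite fracl_eq -(pshift_cstl u f).
rewrite -(fracl_eq f q) pshiftM; congr (_ * _).
by rewrite (raddfB (pshift u)) (raddfB (@cstl R)) /= pshift_varl pshift_cstl; ring.
Qed.

Lemma dp_iter_ddir u l x : dp (iter l (ddir u) x) = iter l (ddir u) (dp x).
Proof. by elim: l => //= l IH; rewrite [LHS]dp_cstlM IH. Qed.

Lemma pshift_dp u x : pshift u (dp x) = dp (pshift u x).
Proof.
have [d dx] := laurent_deg x; apply: laurentP => j; rewrite dpE.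
pose L := (absz (d - j)%R).+1.
rewrite -[LHS]/(shift_fun u (dp x) j) -[pshift u x _]/(shift_fun u x (j + 1)).
rewrite (shift_window (L := L) u dx); last by rewrite /L; lia.
rewrite (shift_window (L := L) u (deg_le_dp dx)); last by rewrite /L; lia.
rewrite -dpE /taylor_sum raddf_sum; congr (lval _ _).
by apply: eq_bigr => l _; rewrite /= dp_cstlM dp_iter_ddir.
Qed.

(** * Polynomial parts and evaluation *)

Definition laurent_poly x : Prop := forall j, j < 0 -> x j = 0.

Lemma pshift_poly u x : laurent_poly x -> laurent_poly (pshift u x).
Proof.
move=> px j j0; have [d dx] := laurent_deg x.
rewrite -[LHS]/(shift_fun u x j).
rewrite (shift_window (L := (absz (d - j)%R).+1) u dx); last by lia.
rewrite lval_sum big1 // => l _; rewrite cstlM.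
suff -> : iter l (ddir u) x j = 0 by rewrite mulr0.
move: (nat_of_ord l) => {l} k; elim: k j j0 => [|m IH] j j0; first exact: px.
(* In degree -1 the derivative carries the factor j + 1 = 0, so d/dp creates no negative power from
   p^0. *)
rewrite iterS cstlM dpE; have [->|j1] := eqVneq (j + 1) 0.
  by rewrite mulr0z mulr0.
by rewrite IH ?mul0rz ?mulr0 //; lia.
Qed.

Definition poly_part (W : nat) x : {poly tfun R} := \poly_(i < W) x i%:Z.

Lemma leval_poly (W : nat) x q : deg_le W%:Z x ->
  leval x q = (poly_part W.+1 x).[q].
Proof.
move=> dx; rewrite (horner_coef_wide _ (size_poly _ _)) /leval.
rewrite (fsbigE (iota 0 W.+1)).
- rewrite -[in iota 0 W.+1](subn0 W.+1) -/(index_iota 0 W.+1) big_mkord.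
  rewrite (eq_bigl xpredT) => [|i]; last by rewrite in_setT.
  by apply: eq_bigr => i _; rewrite coef_poly ltn_ord.
- exact: iota_uniq.
- by [].
- move=> l _; rewrite mem_iota /= add0n -leqNgt => Wl.
  by rewrite dx ?mul0r //; lia.
Qed.

Lemma poly_part_dp (W : nat) x : deg_le W%:Z x ->
  (poly_part W.+1 x)^`() = poly_part W.+1 (dp x).
Proof.
move=> dx; apply/polyP => i; rewrite coef_deriv !coef_poly dpE.
have -> : i%:Z + 1 = i.+1%:Z by lia.
have [iW|iW] := ltnP i W; first by rewrite !ifT // ltnS ltnW.
by rewrite dx ?mul0rz ?if_same ?mul0rn //; lia.
Qed.

Lemma poly_part_is_zmod_morphism W : zmod_morphism (poly_part W).
Proof.
move=> x y; apply/polyP => i; rewrite coefB !coef_poly.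
by case: ifP => //; rewrite subr0.
Qed.
HB.instance Definition _ W := GRing.isZmodMorphism.Build _ _ (poly_part W)
  (poly_part_is_zmod_morphism W).

Lemma poly_part_cstlM W f x : poly_part W (cstl f * x) = f *: poly_part W x.
Proof.
apply/polyP => i; rewrite coefZ !coef_poly cstlM.
by case: ifP => //; rewrite mulr0.
Qed.

Lemma poly_part_iter_ddir (W : nat) u l x : deg_le W%:Z x ->
  poly_part W.+1 (iter l (ddir u) x) = u ^+ l *: (poly_part W.+1 x)^`(l).
Proof.
move=> dx; elim: l => [|l IH]; first by rewrite scale1r.
rewrite iterS /ddir poly_part_cstlM -poly_part_dp; last first.
  by apply: deg_le_trans (deg_le_iter_ddir u (l := l) dx); lia.
by rewrite IH derivZ scalerA -exprS -derivnS.
Qed.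

(** This is Taylor's formula for the polynomial part. Negative powers of x do not interfere, since
    d/dp never turns them into nonnegative ones. *)
Lemma leval_pshift u x q : leval (pshift u x) q = leval x (q + u).
Proof.
have [d dx] := laurent_deg x; pose W := absz d.
have {}dx : deg_le W%:Z x by apply: deg_le_trans dx; rewrite /W; lia.
rewrite (leval_poly _ dx) (leval_poly _ (deg_le_pshift u dx)).
have -> : poly_part W.+1 (pshift u x) = poly_part W.+1 (taylor_sum u W.+1 x).
  apply/polyP => i; rewrite !coef_poly; case: ifP => // _.
  by rewrite -[pshift u x _]/(shift_fun u x i) (shift_window (L := W.+1) u dx) //; lia.
rewrite raddf_sum horner_sum.
rewrite (nderiv_taylor_wide (mulrC q u) (size_poly _ _)).
apply: eq_bigr => l _ /=.
rewrite poly_part_cstlM poly_part_iter_ddir // !hornerZ mulrC -mulrA mulrC.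
congr (_ * _); rewrite nderivn_def hornerMn -mulr_natr -mulrA natr_tfun.
apply: funext => T; rewrite -[LHS]/(_ * (l`!%:R * l`!%:R^-1)).
by rewrite divff ?mulr1 // pnatr_eq0 -lt0n fact_gt0.
Qed.

End ShiftOperator.

(** * Partial derivatives *)

Section PartialDerivatives.
Variable R : realType.
Implicit Types (f g q u : tfun R) (i j : nat) (T : times R).

Record pderivable i f : Prop := Pderivable { pderivable_at :>
  forall T, derivable (fun t : R => f (set_coord T i t)) (T i) 1 }.

Lemma set_coord_same T i (s t : R) :
  set_coord (set_coord T i s) i t = set_coord T i t.
Proof. by apply: funext => l; rewrite /set_coord; case: eqP. Qed.

Lemma set_coord_id T i : set_coord T i (T i) = T.
Proof. by apply: funext => l; rewrite /set_coord; case: eqP => [->|]. Qed.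

Lemma set_coord_at T i (s : R) : set_coord T i s i = s.
Proof. by rewrite /set_coord eqxx. Qed.

Lemma set_coord_ne T i j (s : R) : j != i -> set_coord T i s j = T j.
Proof. by rewrite /set_coord => /negPf->. Qed.

Lemma set_coordC T i j (s t : R) : i != j ->
  set_coord (set_coord T i s) j t = set_coord (set_coord T j t) i s.
Proof.
move=> ij; apply: funext => l; rewrite /set_coord.
by case: (eqVneq l j) => [->|//]; rewrite eq_sym (negPf ij).
Qed.

Lemma pderivable_line i f T (s : R) : pderivable i f ->
  is_derive s 1 (fun t : R => f (set_coord T i t)) (pd i f (set_coord T i s)).
Proof.
move=> df; have := df (set_coord T i s); rewrite set_coord_at.
have E : (fun t : R => f (set_coord (set_coord T i s) i t)) =
    (fun t => f (set_coord T i t)).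
  by apply: funext => t; rewrite set_coord_same.
by rewrite E => dfs; apply: DeriveDef => //; rewrite /pd set_coord_at derive1E E.
Qed.

Lemma line_MVT i f T (a b : R) : pderivable i f -> a < b ->
  exists2 c, a < c < b & f (set_coord T i b) - f (set_coord T i a) =
    pd i f (set_coord T i c) * (b - a).
Proof.
move=> df ab.
have [||c cab fc] := @MVT R (fun t => f (set_coord T i t))
  (fun t => pd i f (set_coord T i t)) a b ab.
- by move=> s _; exact: pderivable_line.
- apply: continuous_subspaceT => s; apply: differentiable_continuous.
  by apply/derivable1_diffP; have [] := pderivable_line T s df.
- by exists c => //; rewrite in_itv in cab.
Qed.

Lemma pderivable_cst i (c : R) : pderivable i (cst c).
Proof. by split=> T; exact: derivable_cst. Qed.

Lemma pderivableD i f g : pderivable i f -> pderivable i g ->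
  pderivable i (f + g).
Proof. by move=> df dg; split=> T; exact: (derivableD (df T) (dg T)). Qed.

Lemma pderivableN i f : pderivable i f -> pderivable i (- f).
Proof. by move=> df; split=> T; exact: (derivableN (df T)). Qed.

Lemma pderivableB i f g : pderivable i f -> pderivable i g ->
  pderivable i (f - g).
Proof. by move=> df dg; exact: (pderivableD df (pderivableN dg)). Qed.

Lemma pderivableM i f g : pderivable i f -> pderivable i g ->
  pderivable i (f * g).
Proof. by move=> df dg; split=> T; exact: (derivableM (df T) (dg T)). Qed.

Lemma pderivableX i f n : pderivable i f -> pderivable i (f ^+ n).
Proof.
move=> df; elim: n => [|n IH]; first exact: pderivable_cst.
by rewrite exprS; exact: pderivableM.
Qed.

Lemma pderivable_sum i (I : Type) (r : seq I) (F : I -> tfun R) :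
  (forall k, pderivable i (F k)) -> pderivable i (\sum_(k <- r) F k).
Proof.
move=> dF; elim: r => [|k r IH]; first by rewrite big_nil; exact: pderivable_cst.
by rewrite big_cons; exact: pderivableD.
Qed.

Lemma pd_cst i (c : R) : pd i (cst c) = 0.
Proof. by apply: funext => T; rewrite /pd derive1_cst. Qed.

Lemma pd0 i : pd i (0 : tfun R) = 0.
Proof. exact: pd_cst. Qed.

Lemma pdD i f g : pderivable i f -> pderivable i g ->
  pd i (f + g) = pd i f + pd i g.
Proof.
move=> df dg; apply: funext => T.
by rewrite /pd derive1E (deriveD (df T) (dg T)) -!derive1E.
Qed.

Lemma pdN i f : pderivable i f -> pd i (- f) = - pd i f.
Proof.
move=> df; apply: funext => T.
by rewrite /pd derive1E (deriveN (df T)) -!derive1E.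
Qed.

Lemma pdB i f g : pderivable i f -> pderivable i g ->
  pd i (f - g) = pd i f - pd i g.
Proof. by move=> df dg; rewrite (pdD df (pderivableN dg)) (pdN dg). Qed.

Lemma pdM i f g : pderivable i f -> pderivable i g ->
  pd i (f * g) = pd i f * g + f * pd i g.
Proof.
move=> df dg; apply: funext => T.
rewrite /pd derive1E (deriveM (df T) (dg T)) -!derive1E set_coord_id addrC.
by congr (_ + _); exact: mulrC.
Qed.

Lemma pd_sum i (I : Type) (r : seq I) (F : I -> tfun R) :
  (forall k, pderivable i (F k)) ->
  pd i (\sum_(k <- r) F k) = \sum_(k <- r) pd i (F k).
Proof.
move=> dF; elim: r => [|k r IH]; first by rewrite !big_nil pd0.
by rewrite !big_cons pdD ?IH//; exact: pderivable_sum.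
Qed.

(** * Symmetry of second partial derivatives *)

Lemma second_difference f T i j (h : R) : i != j -> 0 < h ->
    pderivable i f -> pderivable j (pd i f) ->
  let F s t := f (set_coord (set_coord T i s) j t) in
  exists s t, [/\ T i < s < T i + h, T j < t < T j + h &
    F (T i + h) (T j + h) - F (T i + h) (T j) -
      (F (T i) (T j + h) - F (T i) (T j)) =
    pd j (pd i f) (set_coord (set_coord T i s) j t) * h * h].
Proof.
move=> ij h0 df ddf F.
(* The second difference of f is the increment of G in direction i; the mean value theorem is
   applied to G along i, then to [pd i f] along j. *)
pose G : tfun R := fun T' => f (set_coord T' j (T j + h)) - f (set_coord T' j (T j)).
have dfj (c : R) : pderivable i (fun T' => f (set_coord T' j c)).
  split=> T'; rewrite (_ : (fun _ => _) =
      (fun s => f (set_coord (set_coord T' j c) i s))).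
    by have [] := pderivable_line (set_coord T' j c) (T' i) df.
  by apply: funext => s; rewrite set_coordC.
have pdj (c : R) T' : pd i (fun T' => f (set_coord T' j c)) T' =
    pd i f (set_coord T' j c).
  rewrite /pd (set_coord_ne _ _ ij); congr (derive1 _ (T' i)).
  by apply: funext => s; rewrite set_coordC.
have dG : pderivable i G by exact: (pderivableB (dfj _) (dfj _)).
have ltDr c : c < c + h by rewrite ltrDl.
have [s sh Gs] := line_MVT T dG (ltDr (T i)).
have pdG : pd i G (set_coord T i s) =
    pd i f (set_coord (set_coord T i s) j (T j + h)) -
    pd i f (set_coord (set_coord T i s) j (T j)).
  by have -> : pd i G = _ := pdB (dfj _) (dfj _); rewrite -!pdj.
have [t th ft] := line_MVT (set_coord T i s) ddf (ltDr (T j)).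
exists s, t; split=> //.
by move: Gs; rewrite /G pdG ft !(addrC (T _)) !addrK.
Qed.

Lemma set_coords_row m T T' :
  (forall l, (m <= l)%N -> T' l = T l) ->
  T' = set_coords T (\row_(l < m) T' l).
Proof.
move=> ET; apply: funext => l; rewrite /set_coords.
by case: insubP => [k _ <-|/=]; [rewrite mxE | rewrite -leqNgt => /ET].
Qed.

(** Smoothness gives joint continuity in finitely many coordinates only, hence the requirement that
    T' agree with T from index m on. *)
Lemma smooth_near f T m (e : R) : smooth f -> 0 < e ->
  forall s : seq nat, let g := foldr (@pd R) f s in
  exists2 d : R, 0 < d & forall T',
    (forall l, (m <= l)%N -> T' l = T l) ->
    (forall l, `|T l - T' l| < d) -> `|g T - g T'| < e.
Proof.
move=> sf e0 s g; have [_ /(_ m T) cg] := sf s.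
have := cg (\row_(l < m) T l); rewrite -/g => /cvgrPdist_lt/(_ e e0).
move=> /nbhs_ballP[d /= d0 dg]; exists d => // T' TT' dT'.
rewrite (@set_coords_row m T T') // {1}(@set_coords_row m T T) //.
by apply: dg; split=> // a l; rewrite !mxE; exact: dT'.
Qed.

Lemma smooth_pderivable f i : smooth f -> pderivable i f.
Proof. by move=> sf; split=> T; have [+ _] := sf [::]; apply. Qed.

Lemma smooth_pd f i : smooth f -> smooth (pd i f).
Proof. by move=> sf s; have := sf (rcons s i); rewrite foldr_rcons. Qed.

Lemma dist_lt (a s h d : R) : a < s < a + h -> h < d -> `|a - s| < d.
Proof. by move=> /andP[sa sh] hd; rewrite ltr_norml; lra. Qed.

Lemma set_coord2_close T i j (s t h d : R) : 0 < h ->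
  T i < s < T i + h -> T j < t < T j + h -> h < d ->
  (forall l, (maxn i j < l)%N -> set_coord (set_coord T i s) j t l = T l) /\
  (forall l, `|T l - set_coord (set_coord T i s) j t l| < d).
Proof.
move=> h0 sh th hd; split=> l.
  by rewrite gtn_max => /andP[il jl]; rewrite !set_coord_ne // gtn_eqF.
have [->|lj] := eqVneq l j; first by rewrite set_coord_at (dist_lt th).
rewrite (set_coord_ne _ _ lj).
have [->|li] := eqVneq l i; first by rewrite set_coord_at (dist_lt sh).
by rewrite (set_coord_ne _ _ li) subrr normr0 (lt_trans h0).
Qed.

Lemma dist_halves (x y z e : R) :
  `|y - z| < e / 2 -> `|x - z| < e / 2 -> `|x - y| <= e.
Proof. by rewrite !ltr_norml ler_norml => /andP[? ?] /andP[? ?]; lra. Qed.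

Lemma second_difference_uniq (a b c d p q h : R) : 0 < h ->
  a - b - (c - d) = p * h * h -> a - c - (b - d) = q * h * h -> p = q.
Proof.
move=> h0 D1 D2; apply: (@mulIf _ (h * h)); first by rewrite mulf_neq0 // gt_eqF.
by rewrite !mulrA -D1 -D2; ring.
Qed.

(** The same second difference, expanded in both orders, equates the two mixed derivatives at two
    points within h of T; continuity of each then bounds their difference at T by any e > 0. *)
Lemma smooth_pdC f i j : smooth f -> pd i (pd j f) = pd j (pd i f).
Proof.
move=> sf; have [->//|ij] := eqVneq i j; apply: funext => T.
apply/eqP; rewrite -subr_eq0 -normr_le0; apply/ler_addgt0Pr => e e0.
rewrite add0r; have e2 : 0 < e / 2 by rewrite divr_gt0.
(* The first m coordinates include both i and j, the only ones that move. *)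
pose m := (maxn i j).+1.
have [d1 d10 near1] := smooth_near T m sf e2 [:: i; j].
have [d2 d20 near2] := smooth_near T m sf e2 [:: j; i].
pose h := Num.min d1 d2 / 2.
have h0 : 0 < h by rewrite divr_gt0 // lt_min d10.
have [hd1 hd2] : h < d1 /\ h < d2.
  have : h < Num.min d1 d2 by rewrite /h ltr_pdivrMr // ltr_pMr ?lt_min ?d10 // ltr1n.
  by rewrite lt_min => /andP[].
have dfi : pderivable i f := @smooth_pderivable f i sf.
have dfj : pderivable j f := @smooth_pderivable f j sf.
have dfij : pderivable j (pd i f) := @smooth_pderivable _ j (@smooth_pd f i sf).
have dfji : pderivable i (pd j f) := @smooth_pderivable _ i (@smooth_pd f j sf).
have ji : j != i by rewrite eq_sym.
have [s1 [t1 [s1h t1h D1]]] := second_difference T ij h0 dfi dfij.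
have [t2 [s2 [t2h s2h D2]]] := second_difference T ji h0 dfj dfji.
have [c1a c1b] := set_coord2_close h0 s1h t1h hd2.
have [c2a c2b] := set_coord2_close h0 s2h t2h hd1.
have /= := near1 _ c2a c2b; have /= := near2 _ c1a c1b.
move: D2; rewrite /= -!(set_coordC T _ _ ij) => D2.
rewrite -(second_difference_uniq h0 D1 D2); exact: dist_halves.
Qed.

End PartialDerivatives.

(** * The shift and the time derivatives *)

Section TimeDerivatives.
Variable R : realType.
Implicit Types (x y : laurent R) (f g q u phi : tfun R) (j : int).
Implicit Types (i k l L n : nat).

Fact dTl_subproof k x : ldT k x \in @lbounded R.
Proof.
have [d dx] := laurent_deg x; apply/lboundedP; exists d => j dj.
by rewrite /ldT dx // [LHS]pd0.
Qed.
Definition dTl k x : laurent R := Laurent (dTl_subproof k x).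

Lemma dTlE k x j : dTl k x j = dT k (x j). Proof. by []. Qed.

Lemma deg_le_dTl d k x : deg_le d x -> deg_le d (dTl k x).
Proof. by move=> dx j dj; rewrite dTlE dx // [LHS]pd0. Qed.

Definition lderivable x : Prop := forall i j, pderivable i (x j).

Lemma pderivable0 i : pderivable i (0 : tfun R).
Proof. exact: pderivable_cst. Qed.

Lemma lderivable_cstl f : (forall i, pderivable i f) -> lderivable (cstl f).
Proof.
by move=> df i j; rewrite /= /lconst; case: eqP => // _; exact: pderivable0.
Qed.

Lemma lderivableM x y : lderivable x -> lderivable y -> lderivable (x * y).
Proof.
move=> Dx Dy i j; have [a dx] := laurent_deg x; have [b dy] := laurent_deg y.
rewrite lvalM (lmul_window (W := (absz (a + b - j)%R).+1) dx dy); last by lia.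
by apply: pderivable_sum => l; exact: (pderivableM (Dx _ _) (Dy _ _)).
Qed.

Lemma lderivableX x n : lderivable x -> lderivable (x ^+ n).
Proof.
move=> Dx; elim: n => [|n IH]; last by rewrite exprS; exact: lderivableM.
by apply: lderivable_cstl => i; exact: pderivable_cst.
Qed.

Lemma lderivable_dp x : lderivable x -> lderivable (dp x).
Proof.
move=> Dx i j; rewrite dpE -mulrzr.
have -> : ((j + 1)%:~R : tfun R) = cst (j + 1)%:~R.
  case: (j + 1) => m; first exact: natr_tfun.
  by rewrite NegzE !mulrNz -!pmulrn natr_tfun.
exact: (pderivableM (Dx _ _) (pderivable_cst _ _)).
Qed.

Lemma lderivable_iter_ddir u l x : (forall i, pderivable i u) ->
  lderivable x -> lderivable (iter l (ddir u) x).
Proof.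
move=> Du Dx; elim: l => //= l IH.
exact: (lderivableM (lderivable_cstl Du) (lderivable_dp IH)).
Qed.

Lemma dTlB k x y : lderivable x -> lderivable y ->
  dTl k (x - y) = dTl k x - dTl k y.
Proof.
move=> Dx Dy; apply: laurentP => j; rewrite lvalB !dTlE lvalB.
exact: (pdB (Dx _ _) (Dy _ _)).
Qed.

Lemma dTl_cstl k f : dTl k (cstl f) = cstl (dT k f).
Proof.
apply: laurentP => j; rewrite dTlE /= /lconst.
by case: eqP => // _; exact: pd0.
Qed.

Lemma dTlM k x y : lderivable x -> lderivable y ->
  dTl k (x * y) = dTl k x * y + x * dTl k y.
Proof.
move=> Dx Dy; apply: laurentP => j.
have [a dx] := laurent_deg x; have [b dy] := laurent_deg y.
pose W := (absz (a + b - j)%R).+1.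
have jW : (a + b - j < W%:Z)%R by rewrite /W; lia.
rewrite lvalD dTlE !lvalM (lmul_window dx dy jW).
rewrite (lmul_window (deg_le_dTl k dx) dy jW).
rewrite (lmul_window dx (deg_le_dTl k dy) jW) -big_split.
rewrite /dT pd_sum => [|l]; last exact: (pderivableM (Dx _ _) (Dy _ _)).
by apply: eq_bigr => l _; exact: (pdM (Dx _ _) (Dy _ _)).
Qed.

Lemma pd_mulrz i f (m : int) : pderivable i f -> pd i (f *~ m) = pd i f *~ m.
Proof.
move=> df; have pdn n : pderivable i (f *+ n) /\ pd i (f *+ n) = pd i f *+ n.
  elim: n => [|n [dn IH]]; first by rewrite pd0; split=> //; exact: pderivable0.
  by rewrite mulrS pdD ?IH -?mulrS //; split=> //; rewrite mulrS; exact: pderivableD.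
case: m => n; first by have [_] := pdn n.
by have [dn En] := pdn n.+1; rewrite NegzE !mulrNz -!pmulrn pdN ?En.
Qed.

Lemma dTl_dp k x : lderivable x -> dTl k (dp x) = dp (dTl k x).
Proof. by move=> Dx; apply: laurentP => j; exact: pd_mulrz. Qed.

(** Each of the l + 1 factors u contributes the same term when differentiated, because u and its
    derivative do not involve p and so commute with d/dp. *)
Lemma dTl_iter_ddir k u l x : (forall i, pderivable i u) -> lderivable x ->
  dTl k (iter l.+1 (ddir u) x) = iter l.+1 (ddir u) (dTl k x) +
    (cstl (dT k u) * iter l (ddir u) (dp x)) *+ l.+1.
Proof.
move=> Du Dx; have Dc := lderivable_cstl Du.
have step y : lderivable y ->
    dTl k (ddir u y) = ddir u (dTl k y) + cstl (dT k u) * dp y.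
  move=> Dy; rewrite /ddir dTlM //; last exact: lderivable_dp.
  by rewrite dTl_cstl dTl_dp // addrC.
elim: l => [|l IH]; first by rewrite /= step.
rewrite iterS step; last exact: lderivable_iter_ddir.
have ddirDn y z m : ddir u (y + z *+ m) = ddir u y + ddir u z *+ m.
  by rewrite raddfD raddfMn.
by rewrite IH ddirDn ddir_cstlM dp_iter_ddir -addrA -mulrSr.
Qed.

Lemma lderivable_shift u x : (forall i, pderivable i u) -> lderivable x ->
  lderivable (pshift u x).
Proof.
move=> Du Dx i j; have [d dx] := laurent_deg x.
rewrite -[pshift u x j]/(shift_fun u x j).
rewrite (shift_window (L := (absz (d - j)%R).+1) u dx); last by lia.
rewrite lval_sum; apply: pderivable_sum => l; rewrite cstlM.
exact: (pderivableM (pderivable_cst _ _) (lderivable_iter_ddir _ Du Dx i j)).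
Qed.

(** The chain rule for x(p + u(T), T). *)
Lemma dTl_shift k u x : (forall i, pderivable i u) -> lderivable x ->
  dTl k (pshift u x) = pshift u (dTl k x) + cstl (dT k u) * pshift u (dp x).
Proof.
move=> Du Dx; have [d dx] := laurent_deg x.
have Dt l : lderivable (taylor_term u l x).
  apply: lderivableM; last exact: lderivable_iter_ddir.
  by apply: lderivable_cstl => i; exact: pderivable_cst.
apply: laurentP => j; pose L := (absz (d - j)%R).+1.
rewrite dTlE lvalD cstlM -[pshift u x j]/(shift_fun u x j).
rewrite -[pshift u (dTl k x) j]/(shift_fun u (dTl k x) j).
rewrite -[pshift u (dp x) j]/(shift_fun u (dp x) j).
(* The windows differ by one because differentiating u in the term of order l + 1 of x yields the
   term of order l of [dp x], with (l + 1) / (l + 1)! = 1 / l!. *)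
rewrite (shift_window (L := L.+1) u dx); last by rewrite /L; lia.
rewrite (shift_window (L := L.+1) u (deg_le_dTl k dx)); last by rewrite /L; lia.
rewrite (shift_window (L := L) u (deg_le_dp dx)); last by rewrite /L; lia.
rewrite -cstlM -lvalD -dTlE; congr (lval _ j).
transitivity (\sum_(l < L.+1) dTl k (taylor_term u l x)).
  apply: laurentP => m; rewrite dTlE !lval_sum [LHS]pd_sum //.
  by move=> l; exact: Dt.
rewrite big_ord_recl taylor_term0 /taylor_sum [in RHS]big_ord_recl taylor_term0.
rewrite -addrA mulr_sumr -big_split; congr (_ + _); apply: eq_bigr => l _.
rewrite /= /bump add1n /taylor_term dTlM; last 2 first.
- by apply: lderivable_cstl => i; exact: pderivable_cst.
- exact: lderivable_iter_ddir.
rewrite dTl_cstl [dT _ (cst _)]pd_cst raddf0 mul0r add0r dTl_iter_ddir //.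
rewrite mulrDr; congr (_ + _).
by rewrite mulrnAr -mulrnAl inv_factS; ring.
Qed.

Lemma leval_bound x : exists W : nat, deg_le W%:Z x.
Proof.
have [d dx] := laurent_deg x; exists (absz d).
by apply: deg_le_trans dx; lia.
Qed.

Lemma lderivable_leval i x q : lderivable x -> pderivable i q ->
  pderivable i (leval x q).
Proof.
move=> Dx Dq; have [W dx] := leval_bound x.
rewrite (leval_poly _ dx) (horner_coef_wide _ (size_poly _ _)).
apply: pderivable_sum => l; apply: pderivableM; last exact: pderivableX.
by rewrite coef_poly ltn_ord; exact: Dx.
Qed.

Lemma leval_subC x f q : leval (x - cstl f : laurent R) q = leval x q - f.
Proof.
have [W dx] := leval_bound x; have dc : deg_le W%:Z (cstl f).
  by apply: deg_le_trans (@deg_le_lconst _ f).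
have db : deg_le W%:Z (x - cstl f : laurent R) := deg_leB dx dc.
rewrite (leval_poly _ db) (leval_poly _ dx).
rewrite (raddfB (poly_part W.+1)) hornerD hornerN; congr (_ - _).
have cE : poly_part W.+1 (cstl f) = f%:P.
  by apply/polyP => -[|l]; rewrite coef_poly coefC // if_same.
by rewrite /= cE hornerC.
Qed.

Lemma leval0 x : leval x 0 = x 0.
Proof.
have [W dx] := leval_bound x.
by rewrite (leval_poly _ dx) horner_coef0 coef_poly.
Qed.

(** * The zero curvature equation under the shift *)

Definition poissonl x y : laurent R := dp x * dTl 1 y - dTl 1 x * dp y.

Lemma bracket_lval x y : bracket x y = poissonl x y.
Proof. by []. Qed.

Definition zero_curv k n B M : Prop :=
  dTl n B - dTl k M + poissonl B M = 0.

Lemma zero_curvE k n B M : ldT n (lval B) - ldT k (lval M) + bracket B M = 0 <->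
  zero_curv k n B M.
Proof.
split=> [H|H]; last exact: (congr1 (@lval R) H).
exact: val_inj.
Qed.

(** Here b and m stand for the shifts of B_{T_n} and M_{T_k}, primes for p-derivatives, X for
    X-derivatives, uk, un, uX for the derivatives of u, and c for the mixed derivative of phi in T_k
    and T_n. *)
Lemma zero_curv_alg (V : comNzRingType) (b m b' m' bX mX uk un uX c : V) :
  b - m + (b' * mX - bX * m') = 0 ->
  b + un * b' - c - (m + uk * m' - c) +
    (b' * (mX + uX * m' - un) - (bX + uX * b' - uk) * m') = 0.
Proof. by move=> <-; ring. Qed.

Lemma zero_curv_shift k n phi B M : smooth phi -> lderivable B -> lderivable M ->
  zero_curv k n B M ->
  zero_curv k n (pshift (dX phi) B - cstl (dT k phi))
                (pshift (dX phi) M - cstl (dT n phi)).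
Proof.
move=> sphi DB DM; set u := dX phi.
have Du i : pderivable i u by apply: smooth_pderivable; exact: smooth_pd.
have DT l : lderivable (cstl (dT l phi)).
  by apply: lderivable_cstl => i; apply: smooth_pderivable; exact: smooth_pd.
have DSB := lderivable_shift Du DB; have DSM := lderivable_shift Du DM.
rewrite /zero_curv /poissonl => H.
rewrite !(dTlB _ DSB (DT _)) !(dTlB _ DSM (DT _)) !dTl_shift // !(raddfB (@dp R)) /=.
rewrite !dp_cstl !subr0 -!pshift_dp !dTl_cstl.
(* The X-derivatives of the subtracted functions become time derivatives of u and cancel those
   produced by the chain rule. *)
have uE l : dT l u = dT 1 (dT l phi) by exact: smooth_pdC.
rewrite -!uE.
have -> : dT n (dT k phi) = dT k (dT n phi) by exact: smooth_pdC.
have := congr1 (pshift u) H.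
rewrite pshiftD !pshiftB !pshiftM [pshift u 0]raddf0 => E.
exact: zero_curv_alg E.
Qed.

(** * Truncations, the exponential of ad, and roots of shifted series *)

Fact trunc_subproof (r : int) x : trunc_ge r x \in @lbounded R.
Proof.
have [d dx] := laurent_deg x; apply/lboundedP; exists d => j dj.
by rewrite /trunc_ge dx // if_same.
Qed.
Definition truncl (r : int) x : laurent R := Laurent (trunc_subproof r x).

Lemma lderivable_truncl r x : lderivable x -> lderivable (truncl r x).
Proof.
by move=> Dx i j; rewrite /= /trunc_ge; case: ifP => // _; exact: pderivable0.
Qed.

Lemma laurent_poly_truncl x : laurent_poly (truncl 0 x).
Proof. by move=> j j0; rewrite /= /trunc_ge ifF //; lia. Qed.

Lemma truncl_eq r x y : deg_le (r - 1) (x - y) -> truncl r x = truncl r y.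
Proof.
move=> dxy; apply: laurentP => j; rewrite /= /trunc_ge; case: ifP => // rj.
by apply/eqP; rewrite -subr_eq0 -lvalB dxy //; lia.
Qed.

(** The shift keeps negative powers negative and polynomials polynomial, so truncating at 1 only
    removes the constant term of the shifted polynomial part, which is its value at p = u. *)
Lemma truncl1_shift u x :
  truncl 1 (pshift u x) = pshift u (truncl 0 x) - cstl (leval (truncl 0 x) u).
Proof.
have -> : truncl 1 (pshift u x) = truncl 1 (pshift u (truncl 0 x)).
  apply: truncl_eq; rewrite -raddfB /=.
  apply: (@deg_le_trans _ (- 1)) => //; apply: deg_le_pshift => j j1.
  by rewrite lvalB /= /trunc_ge ifT ?subrr //; lia.
apply: laurentP => j; rewrite lvalB -[leval _ u]/(leval (truncl 0 x) u).
have -> : leval (truncl 0 x) u = pshift u (truncl 0 x) 0.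
  by rewrite -leval0 leval_pshift add0r.
rewrite [LHS]/= /trunc_ge [cstl _ j]/= /lconst.
have [j1|j1] := ltP j 1; last by rewrite gt_eqF ?subr0 // (lt_le_trans _ j1).
have [->|j0] := eqVneq j 0; first by rewrite subrr.
by rewrite subr0 pshift_poly //; [exact: laurent_poly_truncl | lia].
Qed.

(** As phi does not involve p, its bracket is the operator - u d/dp, and the sign (-1)^l of the l-th
    iterate cancels that of the exponential. *)
Lemma exp_ad_opp_shift phi x :
  exp_ad_opp phi x = lval (pshift (dX phi) x).
Proof.
have ad (y : laurent R) : bracket (lconst phi) y = lval (- ddir (dX phi) y).
  rewrite -[lconst phi]/(lval (cstl phi)) bracket_lval /poissonl dp_cstl.
  by rewrite dTl_cstl mul0r sub0r.
have adl l : iter l (bracket (lconst phi)) x =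
    lval (iter l (ddir (dX phi)) x *~ ((-1) ^+ l)).
  elim: l => [|l IH]; first by rewrite expr0 mulr1z.
  by rewrite !iterS IH ad raddfMz /= exprS mulN1r mulrNz.
apply: funext => j; apply: eq_fsbigr => l _; rewrite adl cstlM.
have -> : (iter l (ddir (dX phi)) x *~ (-1) ^+ l) j =
    cst ((-1) ^+ l) * iter l (ddir (dX phi)) x j.
  rewrite -!(signr_odd _ l); apply: funext => T; case: (odd l).
    by rewrite !expr1 mulrN1z; exact: esym (mulN1r _).
  by rewrite !expr0 mulr1z; exact: esym (mul1r _).
rewrite mulrA; congr (_ * _); apply: funext => T.
rewrite -[LHS]/((-1) ^+ l / l`!%:R * (-1) ^+ l).
by rewrite mulrAC -expr2 sqrr_sign mul1r.
Qed.

Lemma monic_deg_shift n u x : monic_deg n%:Z x -> monic_deg n%:Z (pshift u x).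
Proof.
move=> [dx x1]; split; first exact: deg_le_pshift.
rewrite -[LHS]/(shift_fun u x n) (shift_window (L := 1) u dx); last by lia.
by rewrite /taylor_sum big_ord1 taylor_term0.
Qed.

Lemma truncl1_root_shift k n u f x y : (0 < k)%N -> (k < n)%N ->
  monic_deg 1 x -> monic_deg 1 y -> y ^+ n = pshift u (x ^+ n) - cstl f ->
  truncl 1 (y ^+ k) = truncl 1 (pshift u (x ^+ k)).
Proof.
move=> k0 kn mx my yx; have n0 : (0 < n)%N by exact: ltn_trans kn.
have mz := @monic_deg_shift 1 u x mx.
have d0 : deg_le 0 (y ^+ n - pshift u x ^+ n).
  have -> : y ^+ n - pshift u x ^+ n = 0 - cstl f.
    by rewrite yx rmorphXn /=; ring.
  by apply: deg_leB; [exact: deg_le0 | exact: deg_le_lconst].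
have dk := deg_le_subX k0 my mz (deg_le_root n0 my mz d0).
by apply: truncl_eq; rewrite rmorphXn; apply: deg_le_trans dk; lia.
Qed.

End TimeDerivatives.

(** * From the dKP to the dmKP hierarchy *)

Theorem theorem3p2 (R : realType) (k n N : nat) (K : lseries R)
    (alpha beta : 'I_N -> tfun R) (P phi : tfun R) :
  (1 <= k)%N -> (k < n)%N ->
  sato K ->
  (forall i, smooth (alpha i)) -> (forall i, smooth (beta i)) ->
  smooth P -> smooth phi ->
  let Kn := lpow n K in
  let Bn := trunc_ge 0 Kn in
  let Bk := trunc_ge 0 (lfracpow k n Kn) in
  Kn = Bn + \sum_(i < N) lfrac (alpha i) (beta i) ->
  source_hierarchy k n Bk Kn alpha beta ->
  (forall i T, P T - beta i T != 0) ->
  dT k P = dX (leval Bk P) ->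
  dT n P = dX (leval Bn P + \sum_(i < N) tdiv (alpha i) (P - beta i)) ->
  (forall i T, dX phi T - beta i T != 0) ->
  dT k phi = leval Bk (dX phi) ->
  dT n phi = leval Bn (dX phi)
             + \sum_(i < N) tdiv (alpha i) (dX phi - beta i) ->
  let a := fun i => - alpha i in
  let p := fun i => beta i - dX phi in
  let Ln := trunc_ge 1 (exp_ad_opp phi Kn)
            - \sum_(i < N) (lconst (tdiv (a i) (p i)) + lfrac (a i) (p i)) in
  let Qk := trunc_ge 1 (lfracpow k n Ln) in
  source_hierarchy k n Qk Ln a p.
Proof.
move=> k0 kn [mK K0 sK] salpha sbeta _ sphi Kn Bn Bk KnE [zc ak bk] _ _ _ _.
move=> phik phin a p Ln Qk.
have n0 : (0 < n)%N by exact: ltn_trans kn.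
set u := dX phi.
have Du i : pderivable i u by apply: smooth_pderivable; exact: smooth_pd.
have dK : deg_le 1 K by case: mK.
pose x : laurent R := mkL dK; have mx : monic_deg 1 x by exact/(lmonicE 1).
have Dx : lderivable x by move=> i j; exact: smooth_pderivable.
have KnX : Kn = lval (x ^+ n) by rewrite lval_lpow.
pose B : laurent R := truncl 0 (x ^+ k).
have DB : lderivable B by exact/lderivable_truncl/lderivableX.
have BkE : Bk = lval B.
  (* The chosen n-th root of K^n is K itself, by uniqueness of the monic root. *)
  have [y [yK my yx]] := lroot_exists n0 (monic_degX n mx).
  by rewrite /Bk /lfracpow KnX yK (root_unique n0 my mx yx) -lval_lpow.
rewrite BkE in zc ak bk phik.
have LnE : Ln = lval (pshift u (x ^+ n) - cstl (dT n phi)).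
  pose Bl : laurent R := truncl 0 (x ^+ n).
  have BnE : Bn = lval Bl by rewrite /Bn KnX.
  have fracs (f q : 'I_N -> tfun R) : \sum_(i < N) lfrac (f i) (q i) =
      lval (\sum_(i < N) fracl (f i) (q i)).
    by elim/big_ind2: _ => // A y C z -> ->.
  have KnE' : x ^+ n = Bl + \sum_(i < N) fracl (alpha i) (beta i).
    by apply: val_inj; rewrite -[LHS]KnX KnE BnE fracs.
  have SK : pshift u (x ^+ n) = pshift u Bl - \sum_(i < N) fracl (a i) (p i).
    rewrite KnE' raddfD raddf_sum /= -sumrN; congr (_ + _).
    apply: eq_bigr => i _; rewrite pshift_fracl; apply: laurentP => -[] m.
      by rewrite -[RHS]/(- 0) oppr0.
    by rewrite -[RHS]/(- (- alpha i * _)) mulNr opprK.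
  have consts : \sum_(i < N) (lconst (tdiv (a i) (p i)) + lfrac (a i) (p i)) =
      lval (cstl (\sum_(i < N) tdiv (a i) (p i)) +
        \sum_(i < N) fracl (a i) (p i)).
    rewrite raddf_sum -big_split /=.
    by elim/big_ind2: _ => // A y C z -> ->.
  rewrite /Ln KnX exp_ad_opp_shift consts.
  rewrite -[trunc_ge 1 _]/(lval (truncl 1 (pshift u (x ^+ n)))) truncl1_shift.
  rewrite -[LHS]/(lval (pshift u Bl - cstl (leval Bl u) -
    (cstl (\sum_(i < N) tdiv (a i) (p i)) + \sum_(i < N) fracl (a i) (p i)))).
  congr lval; rewrite SK phin BnE raddfD /=.
  (* The two sign changes in a_i = - alpha_i and p_i = beta_i - u cancel in the quotient. *)
  have -> : \sum_(i < N) tdiv (alpha i) (dX phi - beta i) =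
      \sum_(i < N) tdiv (a i) (p i).
    apply: eq_bigr => i _; apply: funext => T.
    rewrite -[RHS]/(- alpha i T / (beta i T - u T)) -(opprB (u T)).
    by rewrite invrN mulrNN.
  by rewrite -/u; ring.
have QkE : Qk = lval (pshift u B - cstl (dT k phi)).
  have mLn : monic_deg n%:Z (pshift u (x ^+ n) - cstl (dT n phi)).
    have [dS S1] := monic_deg_shift u (monic_degX n mx); split.
      by apply: deg_leB => //; apply: deg_le_trans (@deg_le_lconst _ _).
    by rewrite lvalB S1 /= /lconst gt_eqF ?subr0.
  have [y [yL my yx]] := lroot_exists n0 mLn.
  rewrite /Qk /lfracpow LnE yL -lval_lpow -[LHS]/(lval (truncl 1 (y ^+ k))).
  by rewrite (truncl1_root_shift k0 kn mx my yx) truncl1_shift phik.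
split=> [|i|i].
- rewrite QkE LnE; apply/zero_curvE.
  apply: zero_curv_shift => //; first exact: lderivableX.
  by apply/zero_curvE; rewrite -KnX.
- have Dai : pderivable 0 (alpha i * leval (ldp B) (beta i)).
    apply: pderivableM; first exact: smooth_pderivable.
    apply: (lderivable_leval (x := dp B)); first exact: lderivable_dp.
    exact: smooth_pderivable.
  rewrite QkE -[ldp _]/(lval (dp (pshift u B - cstl (dT k phi)))).
  have -> : dp (pshift u B - cstl (dT k phi)) = pshift u (dp B).
    by rewrite (raddfB (@dp R)) /= dp_cstl subr0 pshift_dp.
  (* Evaluating the shifted series at p_i means evaluating at p_i + u = beta_i. *)
  rewrite leval_pshift subrK.
  rewrite /a mulNr [LHS]pdN; last exact: smooth_pderivable.
  by rewrite -[pd _ _]/(dT k (alpha i)) ak; exact: esym (pdN Dai).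
- have Dbi : pderivable 0 (leval B (beta i)).
    by apply: lderivable_leval => //; exact: smooth_pderivable.
  rewrite QkE leval_subC leval_pshift subrK.
  have Dphi : pderivable 0 (dT k phi).
    by apply: smooth_pderivable; exact: smooth_pd.
  (* The term - u_{T_k} in the derivative of p_i matches the X-derivative of the function -
     phi_{T_k} in Q_k. *)
  have uE : dT k u = dX (dT k phi) by exact: smooth_pdC.
  transitivity (dT k (beta i) - dT k u).
    by apply: pdB; [exact: smooth_pderivable | exact: Du].
  rewrite bk uE.
  exact: esym (pdB Dbi Dphi).
Qed.
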